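(* Let $X$ be a nonempty set with basepoint $b\in X$, and let $(A^t)_{t\ge 0}$ be a max-plus linear semigroup with kernel on $X$ such that (i) $A^*(x,y)$ is finite for all $x,y\in X$, and (ii) for all $t\ge 0$ and $x,y\in X$, $A^t(x,y)=\sup_\gamma I(\gamma)$, where the supremum is over all paths $\gamma:[0,t]\to X$ from $x$ to $y$. Then a function $h:X\to\mathbb{R}\cup\{-\infty\}$ is harmonic if and only if it can be written $$h=\sup_{w\in \mathscr{M}^m}(\nu(w)+w),$$ where $\nu$ is some upper semicontinuous function from the minimal boundary $\mathscr{M}^m$ to $\mathbb{R}\cup\{-\infty\}$. Moreover, (for $h$ harmonic) $\mu_h$ (restricted to $\mathscr{M}^m$) is the greatest $\nu$ satisfying this equation.
   Context: Semigroup. Write $\mathbb{R}_{\max}=\mathbb{R}\cup\{-\infty\}$ and $\overline{\mathbb{R}}_{\max}=\mathbb{R}\cup\{\pm\infty\}$, with $-\infty$ absorbing for addition; suprema of empty sets are $-\infty$. A max-plus linear semigroup with kernel on a set $X$ is a family $(A^t)_{t\ge0}$ of operators from $\overline{\mathbb{R}}_{\max}^X$ to itself such that each $A^t$ has the form $A^tg(x)=\sup_{y\in X}(A^t(x,y)+g(y))$ for some kernel $(x,y)\mapsto A^t(x,y)\in\overline{\mathbb{R}}_{\max}$, with $A^0=I$ (the identity operator, with kernel $0$ if $x=y$ and $-\infty$ otherwise) and $A^{s+t}=A^sA^t$ (composition) for all $s,t\ge0$. Equivalently to the last property, $A^{s+t}(x,y)=\sup_{z\in X}(A^s(x,z)+A^t(z,y))$.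 A function $\phi:X\to\mathbb{R}_{\max}$ is harmonic if $A^t\phi=\phi$ for all $t\ge0$. Martin space. Put $A^*=\sup_{t\ge0}A^t$, i.e. $A^*(x,y)=\sup_{t\ge 0}A^t(x,y)$. The Martin kernel is $K(x,y)=A^*(x,y)-A^*(b,y)$. The Martin space $\mathscr{M}$ is the closure of $\mathscr{K}=\{K(\cdot,y)\mid y\in X\}\subset\mathbb{R}^X$ in the topology of pointwise convergence (with the induced topology). For $\xi:X\to\mathbb{R}_{\max}$ and $\eta\in\mathscr{M}$, $$\mu_\xi(\eta):=\inf_{W\ni\eta}\ \sup_{x\in X,\ K(\cdot,x)\in W}\left(A^*(b,x)+\xi(x)\right),$$ the infimum being over all neighbourhoods $W$ of $\eta$ in $\mathscr{M}$. For $\eta,\xi\in\mathscr{M}$ set $H(\eta,\xi):=\mu_\xi(\eta)$. The minimal boundary $\mathscr{M}^m$ is the set of $\xi\in\mathscr{M}$ that are harmonic and satisfy $H(\xi,\xi)=0$. Paths. A path is an arbitrary map $\gamma$ from a closed interval of $\mathbb{R}_+=[0,\infty)$ to $X$. For $t_0<t_1<\dots<t_n$ in the domain of $\gamma$, $I(t_0,\dots,t_n;\gamma):=\sum_{i=0}^{n-1}A^{t_{i+1}-t_i}(\gamma(t_i),\gamma(t_{i+1}))$. The reward of $\gamma:[s_0,s_1]\to X$ is $I(\gamma):=\inf I(t_0,\dots,t_n;\gamma)$, the infimum being over all finite increasing sequences in $[s_0,s_1]$ with $t_0=s_0$ and $t_n=s_1$. *)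

(* Defs.v *)
From mathcomp Require Import all_boot all_order all_algebra.
From mathcomp Require Import all_classical all_reals all_analysis.

Set Implicit Arguments.
Unset Strict Implicit.
Unset Printing Implicit Defensive.

Import Order.TTheory GRing.Theory Num.Theory.
Import numFieldNormedType.Exports.

Local Open Scope classical_set_scope.
Local Open Scope ring_scope.
Local Open Scope ereal_scope.

(* Addition on [\bar R] satisfies [+oo + -oo = -oo], so [-oo] is absorbing as
   max-plus algebra requires; functions with values in R U {-oo} are encoded as
   [\bar R]-valued functions that are everywhere [< +oo]. *)

Section max_plus_semigroup.
Context {R : realType} {X : Type}.
Implicit Types (A : R -> X -> X -> \bar R) (g : X -> \bar R) (gamma : R -> X).

(* The operator A^t with kernel [A t]. The kernel can be recovered from the
   operator, so a semigroup is represented by its family of kernels; only times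
   [t >= 0] matter. *)
Definition kernel_op A (t : R) g : X -> \bar R :=
  fun x => ereal_sup [set A t x y + g y | y in [set: X]].

Definition max_plus_semigroup A : Prop :=
  (forall g, kernel_op A 0%R g = g) /\
  (forall s t : R, (0 <= s)%R -> (0 <= t)%R ->
    forall g, kernel_op A (s + t)%R g = kernel_op A s (kernel_op A t g)).

Definition max_plus_harmonic A g : Prop :=
  forall t : R, (0 <= t)%R -> kernel_op A t g = g.

Definition Astar A (x y : X) : \bar R :=
  ereal_sup [set A t x y | t in [set t : R | (0 <= t)%R]].

(* I(t_0, ..., t_n; gamma), where [ts] lists t_1, ..., t_n. *)
Definition subdivision_reward A gamma (t0 : R) (ts : seq R) : \bar R :=
  \sum_(i < size ts)
     A (nth t0 (t0 :: ts) i.+1 - nth t0 (t0 :: ts) i)%R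
       (gamma (nth t0 (t0 :: ts) i)) (gamma (nth t0 (t0 :: ts) i.+1)).

(* A path on [s0, s1] is represented by a total function on R, of which only
   the values on [s0, s1] are used. For s0 = s1 the only subdivision is the
   one with n = 0, of reward 0. *)
Definition path_reward A gamma (s0 s1 : R) : \bar R :=
  ereal_inf [set subdivision_reward A gamma s0 ts
            | ts in [set ts | itv_partition s0 s1 ts]].

End max_plus_semigroup.

Section martin_space.
Context {R : realType} {X : Type}.
Variables (A : R -> X -> X -> \bar R) (b : X).

(* [martin_kernel y] is the function K(., y); [fine] is harmless as the
   difference is finite whenever A^* is. *)
Definition martin_kernel (y : X) : {ptws X -> R} :=
  fun x => fine (Astar A x y - Astar A b y).

Definition martin_space : set {ptws X -> R} := closure (range martin_kernel).

(* [W] ranges over the sets whose trace on the Martin space is a neighbourhood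
   of [eta] in the induced topology. *)
Definition martin_mu (xi : X -> \bar R) (eta : {ptws X -> R}) : \bar R :=
  ereal_inf
    [set ereal_sup [set Astar A b x + xi x | x in [set x | W (martin_kernel x)]]
    | W in [set W | within martin_space (nbhs eta) W]].

Definition martin_H (eta xi : {ptws X -> R}) : \bar R :=
  martin_mu (fun x => (xi x)%:E) eta.

Definition minimal_boundary : set {ptws X -> R} :=
  [set xi | [/\ martin_space xi, max_plus_harmonic A (fun x => (xi x)%:E)
              & martin_H xi xi = 0]].

End martin_space.

Definition upper_semicontinuous {R : realType} {T : topologicalType}
    (f : T -> \bar R) : Prop :=
  forall (x : T) (a : R), f x < a%:E ->
    exists2 V, nbhs x V & forall y, V y -> f y < a%:E.

(* [set_type (minimal_boundary A b)] carries the induced topology. *)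
Definition martin_representation {R : realType} {X : Type}
    (A : R -> X -> X -> \bar R) (b : X) (h : X -> \bar R)
    (nu : set_type (minimal_boundary A b) -> \bar R) : Prop :=
  [/\ upper_semicontinuous nu,
      forall w, nu w < +oo
    & forall x, h x = ereal_sup
        [set nu w + (set_val w x)%:E
        | w in [set: set_type (minimal_boundary A b)]]].

(* Main.v *)
Require Import Defs.
From mathcomp Require Import all_boot all_order all_algebra.
From mathcomp Require Import all_classical all_reals all_analysis.
From mathcomp Require Import lra.

(** Write [S x y] for the finite number A^*(x,y). If [h] is harmonic then
    A^*(x,y) + h(y) <= h(x), hence A^*(b,y) + h(y) <= h(x) - K(x,y); letting
    K(., y) approach [w] gives mu_h(w) + w <= h on the whole Martin space
    ([martin_mu_le]). So mu_h is a subsolution, and the work lies in finding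
    enough points of the minimal boundary at which this bound is almost sharp.

    Fix [x] and a real c < h(x). Since A^1 h = h, a point [y] can be found
    with c < A^1(x,y) + h(y), so that c = A^1(x,y) + c' with c' < h(y), and the
    construction can be repeated from (y, c'). This gives a ray: points y_n and
    numbers p_n < h(y_n) with p_n = A^1(y_n, y_{n+1}) + p_{n+1}
    ([ray_exists]). No sequence of error terms has to be summed, as all the
    slack is kept in the strict inequality p_n < h(y_n).
    Along a ray S(z, y_n) + p_n is nondecreasing in [n] and bounded by h(z);
    let a(z) be its limit. Then:
    - K(., y_n) converges pointwise to w = a - a(b), so [w] is in the Martin
      space ([ray_limit_martin]);
    - [a] is harmonic ([ray_value_harmonic]): following the ray for [k] more
      unit steps turns a trajectory from [z] to y_n of any duration into one
      that lasts at least [t] and ends on the ray, where a(y_m) >= p_m;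
    - if p_n <= g(y_n) for all [n] then A^*(b,y_n) + g(y_n) >= S(b,y_n) + p_n,
      so mu_g(w) >= a(b) ([le_martin_mu_ray]). Taking g = w, up to the constant
      a(b), gives H(w,w) >= 0, hence [w] is in the minimal boundary
      ([ray_limit_minimal]); taking g = h gives
      mu_h(w) + w(x) >= a(x) >= p_0 = c.
    Letting [c] tend to h(x) yields the representation.

    The remaining parts are formal. A supremum of harmonic functions is harmonic
    ([harmonic_sup]). If nu represents [h] then h >= nu(w) + w, and the
    normalisation H(w,w) = 0 gives mu_h(w) >= nu(w) + H(w,w) = nu(w)
    ([le_martin_mu]). Finally mu_h is upper semicontinuous because a
    neighbourhood of [w] is one of all points near [w] ([martin_mu_usc]). *)

Set Implicit Arguments.
Unset Strict Implicit.
Unset Printing Implicit Defensive.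

Import Order.TTheory GRing.Theory Num.Theory.
Import numFieldNormedType.Exports.

Local Open Scope classical_set_scope.
Local Open Scope ring_scope.
Local Open Scope ereal_scope.

(** * Pointwise convergence over an arbitrary index type *)

Section pointwise_convergence.
Context {R : realType} {X : Type}.

Lemma ptws_eval_continuous (x : X) :
  continuous (fun f : {ptws X -> R} => f x).
(* The product topology depends only on the carrier of the index type, so the
   classical equality structure may be put on X. *)
Proof. exact: (@proj_continuous {classic X} (fun=> R) x). Qed.

Lemma ptws_cvg (F : set_system {ptws X -> R}) (f : {ptws X -> R}) :
  Filter F -> (forall x, (fun g : {ptws X -> R} => g x) @ F --> f x) -> F --> f.
Proof.
move=> FF Ff; apply/cvg_sup => x U.
rewrite nbhsE => -[V [[W oW <-] /= Wfx] sVU]; apply: filterS sVU _.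
by apply: Ff; apply: open_nbhs_nbhs.
Qed.

End pointwise_convergence.

(** * Max-plus kernels and the Green kernel A^* *)

Section semigroup.
Context {R : realType} {X : Type} (A : R -> X -> X -> \bar R).
Implicit Types (x y z : X) (s t : R) (g : X -> \bar R).

Lemma kernel_op_ge t g x y : A t x y + g y <= kernel_op A t g x.
Proof. by apply: ereal_sup_ubound; exists y. Qed.

Lemma kernel_op_le t g x (M : \bar R) :
  (forall y, A t x y + g y <= M) -> kernel_op A t g x <= M.
Proof. by move=> gM; apply: ge_ereal_sup => _ [y _ <-]; exact: gM. Qed.

Lemma kernel_op_monotone t (f g : X -> \bar R) x :
  (forall y, f y <= g y) -> kernel_op A t f x <= kernel_op A t g x.
Proof.
move=> fg; apply: kernel_op_le => y.
by apply: le_trans (kernel_op_ge t g x y); exact: leeD2l.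
Qed.

(** The max-plus unit vector at [y]; applying the operators to it recovers the
    kernels, which turns the operator identities into kernel identities. *)
Definition dirac_fun (y : X) : X -> \bar R :=
  fun z => if pselect (z = y) then 0 else -oo.

Lemma dirac_fun_diag y : dirac_fun y y = 0.
Proof. by rewrite /dirac_fun; case: pselect. Qed.

Lemma kernel_op_dirac t x y : kernel_op A t (dirac_fun y) x = A t x y.
Proof.
apply/eqP; rewrite eq_le; apply/andP; split.
  apply: kernel_op_le => z; rewrite /dirac_fun; case: pselect => [zy|_] /=.
    by rewrite zy adde0.
  by rewrite addeNy leNye.
apply: le_trans (kernel_op_ge _ _ _ y).
by rewrite dirac_fun_diag adde0.
Qed.

Context (Asemi : max_plus_semigroup A).

Lemma kernel_diag0 x : A 0%R x x = 0.
Proof.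
by rewrite -kernel_op_dirac Asemi.1 dirac_fun_diag.
Qed.

Lemma kernel_chain s t x z y : (0 <= s)%R -> (0 <= t)%R ->
  A s x z + A t z y <= A (s + t)%R x y.
Proof.
move=> s0 t0; rewrite -(kernel_op_dirac (s + t)) Asemi.2//.
rewrite -[A t z y]kernel_op_dirac; exact: kernel_op_ge.
Qed.

Lemma kernel_le_Astar t x y : (0 <= t)%R -> A t x y <= Astar A x y.
Proof. by move=> t0; apply: ereal_sup_ubound; exists t. Qed.

Context (Astar_fin : forall x y, Astar A x y \is a fin_num).

Local Notation S x y := (fine (Astar A x y)).

Lemma Astar_EFin x y : Astar A x y = (S x y)%:E.
Proof. by rewrite fineK. Qed.

Lemma kernel_le_S t x y : (0 <= t)%R -> A t x y <= (S x y)%:E.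
Proof. by rewrite -Astar_EFin; exact: kernel_le_Astar. Qed.

(** For u = +oo, either A^*(x,y) = -oo absorbs it, or some A^t(x,y) > -oo forces
    v = +oo. *)
Lemma Astar_add_le x y (u v : \bar R) :
  (forall t, (0 <= t)%R -> A t x y + u <= v) -> Astar A x y + u <= v.
Proof.
case: u => [u| |] uv; last by rewrite addeNy leNye.
  rewrite -leeBrDr//; apply: ge_ereal_sup => _ [t t0 <-].
  by rewrite leeBrDr//; exact: uv.
have [->|] := eqVneq (Astar A x y) -oo; first by rewrite addNye leNye.
rewrite -ltNye => /ereal_sup_gt[_ [t t0 <-] At].
apply: le_trans (uv t t0); rewrite [leRHS]addey ?leey//.
by rewrite -ltNye.
Qed.

Lemma Astar_chain x z y : (S x z + S z y <= S x y)%R.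
Proof.
rewrite -lee_fin EFinD -!Astar_EFin.
apply: Astar_add_le => s s0; rewrite addeC; apply: Astar_add_le => t t0.
rewrite addeC; apply: le_trans (kernel_chain x z y s0 t0) _.
by apply: kernel_le_Astar; exact: addr_ge0.
Qed.

Lemma Astar_diag_ge0 x : (0 <= S x x)%R.
Proof. by rewrite -lee_fin -[leLHS](kernel_diag0 x) kernel_le_S. Qed.

Definition superharmonic (g : X -> \bar R) : Prop :=
  forall x y, Astar A x y + g y <= g x.

Lemma harmonic_superharmonic g : max_plus_harmonic A g -> superharmonic g.
Proof.
move=> gh x y; apply: Astar_add_le => t t0.
by rewrite -[X in _ <= X x](gh t t0); exact: kernel_op_ge.
Qed.

(** Max-plus operators commute with suprema and with the addition of
    constants. *)
Lemma harmonic_sup (I : Type) (nu : I -> \bar R) (w : I -> X -> R) g :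
  (forall i, nu i < +oo) ->
  (forall i, max_plus_harmonic A (fun x => (w i x)%:E)) ->
  (forall x, g x = ereal_sup [set nu i + (w i x)%:E | i in [set: I]]) ->
  max_plus_harmonic A g.
Proof.
move=> nufin wh gE.
have gub i x : nu i + (w i x)%:E <= g x.
  by rewrite gE; apply: ereal_sup_ubound; exists i.
move=> t t0; apply/funext => x; apply/eqP; rewrite eq_le; apply/andP; split.
  apply: kernel_op_le => y.
  have := kernel_le_S x y t0.
  case Axy: (A t x y) => [a| |] // _; last by rewrite addNye leNye.
  rewrite -leeBrDl// gE; apply: ge_ereal_sup => _ [i _ <-].
  rewrite leeBrDl// addeCA; apply: le_trans (gub i x).
  apply: leeD2l; rewrite -[leRHS](congr1 (fun f => f x) (wh i t t0)) -Axy.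
  exact: (kernel_op_ge t (fun x => (w i x)%:E)).
rewrite {1}gE; apply: ge_ereal_sup => _ [i _ <-].
have := nufin i; have := gub i.
case: (nu i) => [c| |] // gubi _; last by rewrite addNye leNye.
rewrite -leeBrDl// -(congr1 (fun f => f x) (wh i t t0)).
apply: kernel_op_le => y; rewrite leeBrDl// addeCA.
by apply: le_trans (kernel_op_ge t g x y); exact: leeD2l.
Qed.

(** * The function mu_h on the Martin space *)

Section boundary_measure.
Context (b : X).

Lemma martin_kernelE y x : martin_kernel A b y x = (S x y - S b y)%R.
Proof. by rewrite /martin_kernel fineB. Qed.

Lemma martin_mu_le_sup g (w : {ptws X -> R}) W :
  within (martin_space A b) (nbhs w) W ->
  martin_mu A b g w <= ereal_sup
    [set Astar A b x + g x | x in [set x | W (martin_kernel A b x)]].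
Proof. by move=> Ww; apply: ereal_inf_lbound; exists W. Qed.

(** Where K(x, y) > w(x) - e, superharmonicity gives
    A^*(b,y) + g(y) = A^*(x,y) - K(x,y) + g(y) <= g(x) - w(x) + e. *)
Lemma martin_mu_le g (w : {ptws X -> R}) x : (forall x, g x < +oo) ->
  superharmonic g -> martin_mu A b g w + (w x)%:E <= g x.
Proof.
move=> gfin gs; rewrite -leeBrDr//; apply/lee_addgt0Pr => e e0.
have Ww : within (martin_space A b) (nbhs w)
    [set f : {ptws X -> R} | (w x - e < f x)%R].
  apply: (@filterS _ (nbhs w) _ [set f | (w x - e < f x)%R]) => [f wf _|]; first exact: wf.
  apply: (@ptws_eval_continuous _ _ x w [set r | (w x - e < r)%R]).
  by apply: lt_nbhsr; rewrite ltrBlDr ltrDl.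
apply: le_trans (martin_mu_le_sup g Ww) _.
apply: ge_ereal_sup => _ [y /= + <-]; rewrite martin_kernelE => wy.
have := gs x y; have := gfin x; have := gfin y.
rewrite (Astar_EFin x) (Astar_EFin b).
case: (g y) => [gy| |] //; [|by move=> *; rewrite addeNy leNye].
case: (g x) => [gx| |] //.
by move=> _ _; rewrite -!EFinD !lee_fin; lra.
Qed.

(** mu is monotone and commutes with the addition of a constant, so
    c + w <= g gives c = c + mu_w(w) <= mu_g(w). *)
Lemma le_martin_mu g (w : {ptws X -> R}) (c : \bar R) :
  martin_H A b w w = 0 -> c < +oo ->
  (forall x, c + (w x)%:E <= g x) -> c <= martin_mu A b g w.
Proof.
move=> Hww + cg; case: c cg => [c| |] cg // _; last exact: leNye.
apply: le_ereal_inf_tmp => _ [W Ww <-].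
rewrite -[c%:E]adde0 -leeBrDl//.
rewrite -Hww; apply: le_trans (martin_mu_le_sup _ Ww) _.
apply: ge_ereal_sup => _ [x Wx <-]; rewrite leeBrDl// addeCA.
apply: le_trans (leeD2l _ (cg x)) _.
by apply: ereal_sup_ubound; exists x.
Qed.

(** A set witnessing mu_g(w) < a is a neighbourhood of every [v] in the interior
    of its trace, so it bounds mu_g(v) as well. *)
Lemma martin_mu_usc g :
  upper_semicontinuous (fun w : set_type (minimal_boundary A b) =>
    martin_mu A b g (set_val w)).
Proof.
move=> w a /ereal_inf_lt[_ [W Ww <-] supW].
exists (set_val @^-1` [set v | within (martin_space A b) (nbhs v) W]).
  by apply: initial_continuous; apply: nbhs_interior Ww.
move=> v Wv; apply: le_lt_trans supW; exact: martin_mu_le_sup.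
Qed.

End boundary_measure.

(** * Rays and their limits in the minimal boundary *)

Section rays.
Context (b : X) (y : nat -> X) (p : nat -> R).
Context (step : forall n, (p n)%:E <= A 1%R (y n) (y n.+1) + (p n.+1)%:E).

Lemma ray_chain n k : (p n)%:E <= A k%:R (y n) (y (n + k)%N) + (p (n + k)%N)%:E.
Proof.
elim: k => [|k IH]; first by rewrite addn0 kernel_diag0 add0e.
apply: le_trans IH _; rewrite addnS -natr1.
apply: le_trans (leeD2l _ (step _)) _.
by rewrite addeA; apply: leeD2r; exact: kernel_chain.
Qed.

(** One more step of the ray can be appended to a trajectory from [z] to y_n at
    a cost that the change of [p] compensates. *)
Lemma ray_nondecreasing z : nondecreasing_seq (fun n => S z (y n) + p n)%R.
Proof.
apply/nondecreasing_seqP => n; have := step n.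
have := kernel_le_S (y n) (y n.+1) (@ler01 R).
case: (A 1 _ _) => [a| |] //; rewrite -EFinD !lee_fin.
by have := Astar_chain z (y n) (y n.+1); lra.
Qed.

Context (ray_bounded : forall z, has_ubound (range (fun n => S z (y n) + p n)%R)).

Definition ray_value (z : X) : R := sup (range (fun n => S z (y n) + p n)%R).

Lemma ray_value_cvg z : (fun n => S z (y n) + p n)%R @ \oo --> ray_value z.
Proof. exact: nondecreasing_cvgn (@ray_nondecreasing z) (ray_bounded z). Qed.

Lemma ray_value_ge z n : (S z (y n) + p n <= ray_value z)%R.
Proof. by apply: ub_le_sup; [exact: ray_bounded | exists n]. Qed.

Lemma ray_value_le z (M : R) :
  (forall n, (S z (y n) + p n <= M)%R) -> (ray_value z <= M)%R.
Proof.
by move=> zM; apply: ge_sup; [exists (S z (y 0%N) + p 0%N)%R; exists 0%N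
  | move=> _ [n _ <-]; exact: zM].
Qed.

Lemma ray_value_start n : (p n <= ray_value (y n))%R.
Proof.
by have := ray_value_ge (y n) n; have := Astar_diag_ge0 (y n); lra.
Qed.

Lemma ray_value_superharmonic z u :
  (S z u + ray_value u <= ray_value z)%R.
Proof.
rewrite -lerBrDl; apply: ray_value_le => n.
by have := ray_value_ge z n; have := Astar_chain z u (y n); lra.
Qed.

Definition ray_limit : {ptws X -> R} := fun z => (ray_value z - ray_value b)%R.

(** The Martin kernel is a difference in which the numbers p_n cancel. *)
Lemma ray_limit_cvg : (fun n => martin_kernel A b (y n)) @ \oo --> ray_limit.
Proof.
apply: ptws_cvg => z.
have E : (fun n => martin_kernel A b (y n) z) =
    ((fun n => S z (y n) + p n) \- (fun n => S b (y n) + p n))%R.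
  by apply/funext => n /=; rewrite martin_kernelE; lra.
change ((fun n => martin_kernel A b (y n) z) @ \oo --> ray_limit z).
rewrite E; exact: (cvgB (@ray_value_cvg z) (@ray_value_cvg b)).
Qed.

Lemma ray_limit_martin : martin_space A b ray_limit.
Proof.
move=> U /ray_limit_cvg[N _ NU].
by exists (martin_kernel A b (y N)); split; [exists (y N) | exact: (NU N (leqnn N))].
Qed.

(** For A^t a >= a, take a trajectory of duration [s] from [z] to y_n and follow
    the ray for k >= t further units of time: this shows
    A^s(z,y_n) + p_n <= A^{s+k} a(z) = A^t A^{s+k-t} a(z) <= A^t a(z), and the
    left side has supremum a(z) over [s] and [n]. *)
Lemma ray_value_harmonic : max_plus_harmonic A (fun z => (ray_value z)%:E).
Proof.
have sup t z u : (0 <= t)%R ->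
    A t z u + (ray_value u)%:E <= (ray_value z)%:E.
  move=> t0; apply: le_trans (leeD2r _ (kernel_le_S z u t0)) _.
  by rewrite -EFinD lee_fin; exact: ray_value_superharmonic.
move=> t t0; apply/funext => z; apply/eqP; rewrite eq_le; apply/andP; split.
  by apply: kernel_op_le => u; exact: sup.
have ray n : Astar A z (y n) + (p n)%:E
    <= kernel_op A t (fun z => (ray_value z)%:E) z.
  apply: Astar_add_le => s s0.
  have [k tk] : exists k : nat, (t <= k%:R)%R.
    by exists (Num.trunc t).+1; apply/ltW; exact: truncnS_gt.
  apply: le_trans (leeD2l _ (ray_chain n k)) _; rewrite addeA.
  apply: le_trans (leeD2r _ (kernel_chain z (y n) (y (n + k)%N) s0 (ler0n _ _))) _.
  have -> : (s + k%:R = t + (s + k%:R - t))%R by lra.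
  have r0 : (0 <= s + k%:R - t)%R by lra.
  apply: (@le_trans _ _ (kernel_op A (t + (s + k%:R - t))
    (fun z => (ray_value z)%:E) z)).
    apply: le_trans (kernel_op_ge _ _ _ (y (n + k)%N)).
    by apply: leeD2l; rewrite lee_fin; exact: ray_value_start.
  rewrite Asemi.2//; apply: kernel_op_monotone => u.
  by apply: kernel_op_le => v; exact: sup.
have := ray 0%N; rewrite Astar_EFin -EFinD.
case K : (kernel_op A t _ z) => [v| |] //=; rewrite ?leey// => _.
by rewrite lee_fin; apply: ray_value_le => n; rewrite -lee_fin EFinD -K -Astar_EFin.
Qed.

Lemma ray_limit_harmonic : max_plus_harmonic A (fun z => (ray_limit z)%:E).
Proof.
apply: (@harmonic_sup unit (fun=> (- ray_value b)%:E) (fun=> ray_value)) => //.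
- by move=> _; exact: ltry.
- by move=> _; exact: ray_value_harmonic.
move=> z; rewrite (_ : [set _ | _ in _] = [set (ray_limit z)%:E]) ?ereal_sup1//.
apply/seteqP; split => [_ [_ _ <-] /=|_ ->]; last exists tt => //;
  by rewrite -EFinD /ray_limit addrC.
Qed.

(** Every neighbourhood of the limit contains K(., y_n) for [n] large, and
    A^*(b,y_n) + g(y_n) is at least S(b,y_n) + p_n + c, which tends to
    [ray_value b + c]. *)
Lemma le_martin_mu_ray g (c : R) : (forall n, (p n + c)%:E <= g (y n)) ->
  (ray_value b + c)%:E <= martin_mu A b g ray_limit.
Proof.
move=> pg; apply: le_ereal_inf_tmp => _ [W WK <-].
apply/lee_addgt0Pr => e e0.
have [n [Wn bn]] : exists n, W (martin_kernel A b (y n)) /\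
    (ray_value b - e < S b (y n) + p n)%R.
  have : \forall n \near \oo, W (martin_kernel A b (y n)) /\
      (ray_value b - e < S b (y n) + p n)%R.
    apply: filterI.
      move: (ray_limit_cvg WK); rewrite /= => -[N _ NU]; exists N => // m Nm.
      by apply: (NU m Nm); apply: subset_closure; exists (y m).
    apply: (@ray_value_cvg b [set r | (ray_value b - e < r)%R]).
    by apply: lt_nbhsr; rewrite ltrBlDr ltrDl.
  by move=> [N _ NU]; exists N; exact: (NU N (leqnn N)).
apply: (@le_trans _ _ (Astar A b (y n) + g (y n) + e%:E)).
  rewrite Astar_EFin; apply: le_trans (leeD2r _ (leeD2l _ (pg n))).
  by rewrite -!EFinD lee_fin; lra.
by apply: leeD2r; apply: ereal_sup_ubound; exists (y n).
Qed.

(** H(w,w) <= 0 because [w] is superharmonic with w(b) = 0; H(w,w) >= 0 because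
    a(y_n) >= p_n, that is w(y_n) >= p_n - a(b). *)
Lemma ray_limit_minimal : minimal_boundary A b ray_limit.
Proof.
split; [exact: ray_limit_martin | exact: ray_limit_harmonic |].
apply/eqP; rewrite eq_le; apply/andP; split.
  have := @martin_mu_le b (fun x => (ray_limit x)%:E) ray_limit b.
  rewrite /martin_H -leeBrDr//.
  have -> : ray_limit b = 0%R by rewrite /ray_limit subrr.
  rewrite sube0; apply=> [x|]; first exact: ltry.
  exact/harmonic_superharmonic/ray_limit_harmonic.
have := @le_martin_mu_ray (fun x => (ray_limit x)%:E) (- ray_value b)%R.
rewrite subrr; apply=> n; rewrite lee_fin /ray_limit lerD2r.
exact: ray_value_start.
Qed.

End rays.

(** The state (y, p) with p < g(y) reproduces itself: p < g(y) = A^1 g(y) gives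
    some [v] with p < A^1(y,v) + g(v), so A^1(y,v) is finite and
    p - A^1(y,v) < g(v). *)
Lemma ray_exists g x (c : R) : max_plus_harmonic A g -> c%:E < g x ->
  exists (y : nat -> X) (p : nat -> R),
    [/\ y 0%N = x, p 0%N = c, forall n, (p n)%:E < g (y n) &
        forall n, (p n)%:E = A 1%R (y n) (y n.+1) + (p n.+1)%:E].
Proof.
move=> gh cg; pose T := {s : X * R | (s.2)%:E < g s.1}.
pose next (s s' : T) := (sval s).2%:E =
  A 1%R (sval s).1 (sval s').1 + (sval s').2%:E.
have nextE (s : T) : {s' | next s s'}.
  apply: cid; case: s => -[u q] /= qg.
  have : q%:E < kernel_op A 1%R g u by rewrite gh.
  move=> /ereal_sup_gt[_ [v _ <-]].
  rewrite /next /=; have := kernel_le_S u v (@ler01 R).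
  case Auv : (A 1 u v) => [a| |] // _.
  move=> qa; have gv : (q - a)%:E < g v.
    by rewrite EFinB lteBlDl.
  by exists (exist _ (v, (q - a)%R) gv) => /=; rewrite Auv -EFinD; congr EFin; lra.
have [f [f0 fS]] := dependent_choice nextE (exist _ (x, c) cg).
exists (fun n => (sval (f n)).1), (fun n => (sval (f n)).2).
by split=> [| |n|n]; rewrite ?f0//; [exact: (svalP (f n)) | exact: fS].
Qed.

(** * Representation of harmonic functions *)

(** A ray from [x] with p_0 = g(x) - e provides a boundary point whose term in
    the supremum is at least g(x) - e. *)
Lemma minimal_representation b g x : (forall x, g x < +oo) ->
  max_plus_harmonic A g ->
  g x = ereal_sup [set martin_mu A b g (set_val w) + (set_val w x)%:E
                  | w in [set: set_type (minimal_boundary A b)]].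
Proof.
move=> gfin gh; have gs := harmonic_superharmonic gh.
apply/eqP; rewrite eq_le; apply/andP; split; last first.
  by apply: ge_ereal_sup => _ [w _ <-]; exact: martin_mu_le.
case gx : (g x) (gfin x) => [r| |] // _; last exact: leNye.
apply/lee_addgt0Pr => e e0.
have [|y [p [y0 p0 pg step]]] := @ray_exists g x (r - e)%R gh.
  by rewrite gx lte_fin ltrBlDr ltrDl.
have step' n : (p n)%:E <= A 1%R (y n) (y n.+1) + (p n.+1)%:E by rewrite -step.
have bdd z : has_ubound (range (fun n => S z (y n) + p n)%R).
  exists (fine (g z)) => _ [n _ <-].
  have := gs z (y n); have := pg n; have := gfin z; have := gfin (y n).
  rewrite Astar_EFin; case: (g (y n)) => [gy| |] //; case: (g z) => [gz| |] //.
  by move=> _ _; rewrite lte_fin -EFinD lee_fin /=; lra.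
pose w : set_type (minimal_boundary A b) :=
  SigSub (mem_set (ray_limit_minimal b step' bdd)).
have wE : set_val w = ray_limit b y p by rewrite set_valE.
rewrite -leeBlDr//; apply: (@le_trans _ _
    (martin_mu A b g (set_val w) + (set_val w x)%:E)).
  have := @le_martin_mu_ray b y p step' bdd g 0%R.
  rewrite addr0 => mu_ge; apply: le_trans (leeD2r _ (mu_ge _)).
    have := ray_value_start bdd 0%N.
    rewrite wE y0 p0 -EFinB -EFinD lee_fin /ray_limit; lra.
  by move=> n; rewrite addr0; exact: ltW.
by apply: ereal_sup_ubound; exists w.
Qed.

End semigroup.

Theorem theorem3p11 (R : realType) (X : Type) (b : X)
    (A : R -> X -> X -> \bar R)
    (Asemi : max_plus_semigroup A)
    (Astar_fin : forall x y : X, Astar A x y \is a fin_num)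
    (Apath : forall (t : R) (x y : X), (0 <= t)%R ->
       A t x y = ereal_sup [set path_reward A gamma 0%R t
                           | gamma in [set gamma : R -> X |
                                       gamma 0%R = x /\ gamma t = y]])
    (h : X -> \bar R) (h_ltoo : forall x : X, h x < +oo) :
  (max_plus_harmonic A h <->
     exists nu : set_type (minimal_boundary A b) -> \bar R,
       martin_representation h nu) /\
  (max_plus_harmonic A h ->
     martin_representation h
       (fun w : set_type (minimal_boundary A b) =>
          martin_mu A b h (set_val w)) /\
     (forall nu : set_type (minimal_boundary A b) -> \bar R,
        martin_representation h nu ->
        forall w, nu w <= martin_mu A b h (set_val w))).
Proof.
have boundaryP (w : set_type (minimal_boundary A b)) :
    minimal_boundary A b (set_val w) by exact: set_valP.
have mu_rep : max_plus_harmonic A h -> martin_representation h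
    (fun w : set_type (minimal_boundary A b) => martin_mu A b h (set_val w)).
  move=> hh; split=> [|w|x].
  - exact: martin_mu_usc.
  - have := @martin_mu_le _ _ A Astar_fin b h (set_val w) b h_ltoo
      (harmonic_superharmonic hh).
    by have := h_ltoo b; case: (h b) => [r| |] //; case: martin_mu => //= *;
      exact: ltry.
  - exact: minimal_representation.
split=> [|hh].
  split=> [hh|[nu [_ nufin hE]]]; first by eexists; exact: mu_rep hh.
  apply: (@harmonic_sup _ _ A Astar_fin _ nu (fun w => set_val w)) => //.
  by move=> w; case: (boundaryP w).
split=> [|nu [_ nufin hE] w]; first exact: mu_rep.
case: (boundaryP w) => _ _ Hww; apply: (le_martin_mu Hww (nufin w)) => x.
by rewrite hE; apply: ereal_sup_ubound; exists w.
Qed.
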